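(* Assume the positive sequence $\alpha(n)$ is log-polynomial of some degree $m\ge2$ with data $\{A(n),\kappa,\delta(n)\}$. (i) If $\kappa=-1$, then $\alpha$ is asymptotically strictly log-concave. If $\kappa=1$, then $\alpha$ is asymptotically strictly log-convex. (ii) Fix $d$ with $1\le d\le m+1$. For all sufficiently large $n$, the zeros of $J_\alpha^{d,n}(X)$ and of $K_\alpha^{d,n}(X)$ are all distinct. If $\kappa=-1$, they are all real. If $\kappa=1$, they are all non-real, except for exactly one real zero when $d$ is odd.
   Context: Log-polynomial: let $m\ge2$ be an integer and $\kappa\in\{1,-1\}$. A sequence of positive reals $\alpha(n)$ is log-polynomial of degree $m$ with data $\{A(n),\kappa,\delta(n)\}$ if there are real sequences $A(n),\delta(n),g_k(n)$ ($3\le k\le m$) such that $$\log\left(\frac{\alpha(n+j)}{\alpha(n)}\right)=A(n)j+\kappa\delta(n)^2j^2+\sum_{k=3}^m g_k(n)j^k+o(\delta(n)^{m+1})\quad(n\to\infty)$$ for $j=1,\dots,m+1$. In addition, $\delta(n)>0$, $\delta(n)\to0$ and $g_k(n)=o(\delta(n)^k)$. Jensen polynomials: $J_\alpha^{d,n}(X)=\sum_{j=0}^d\binom{d}{j}\alpha(n+j)X^j$ and $K_\alpha^{d,n}(X)=X^dJ_\alpha^{d,n}(1/X)$. Asymptotically strictly log-concave means $\alpha(n+1)^2>\alpha(n)\alpha(n+2)$ for all large $n$. Asymptotically strictly log-convex means the reverse strict inequality holds for all large $n$. *)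

(* Defs.v *)
From HB Require Import structures.
From mathcomp Require Import all_boot all_order all_algebra.
From mathcomp Require Import all_classical all_reals all_analysis.
From mathcomp Require Import complex.
Set Implicit Arguments. Unset Strict Implicit. Unset Printing Implicit Defensive.
Import Order.TTheory GRing.Theory Num.Theory.
Import numFieldNormedType.Exports.
Local Open Scope classical_set_scope.
Local Open Scope ring_scope.

Definition little_o (R : realType) (f g : nat -> R) : Prop :=
  forall e : R, 0 < e -> exists N : nat, forall n : nat, (N <= n)%N ->
    `|f n| <= e * `|g n|.

Definition log_polynomial (R : realType) (m : nat) (alpha A : nat -> R)
    (kappa : R) (delta : nat -> R) : Prop :=
  (2 <= m)%N /\ (kappa = 1 \/ kappa = -1) /\
  exists g : nat -> nat -> R,
    (forall n, 0 < delta n) /\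
    delta @ \oo --> (0 : R) /\
    (forall k : nat, (3 <= k <= m)%N -> little_o (g k) (fun n => delta n ^+ k)) /\
    (forall j : nat, (1 <= j <= m.+1)%N ->
       little_o
         (fun n => ln (alpha (n + j)%N / alpha n)
                   - (A n * j%:R + kappa * delta n ^+ 2 * j%:R ^+ 2
                      + \sum_(3 <= k < m.+1) g k n * j%:R ^+ k))
         (fun n => delta n ^+ m.+1)).

Definition asymp_strictly_log_concave (R : realType) (alpha : nat -> R) : Prop :=
  exists N : nat, forall n : nat, (N <= n)%N ->
    alpha n * alpha n.+2 < alpha n.+1 ^+ 2.

Definition asymp_strictly_log_convex (R : realType) (alpha : nat -> R) : Prop :=
  exists N : nat, forall n : nat, (N <= n)%N ->
    alpha n.+1 ^+ 2 < alpha n * alpha n.+2.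

Definition jensenJ (R : realType) (alpha : nat -> R) (d n : nat) : {poly R} :=
  \sum_(j < d.+1) ('C(d, j)%:R * alpha (n + j)%N) *: 'X^j.

(* K^{d,n}(X) = X^d J^{d,n}(1/X) = sum_{j=0}^d binom(d,j) alpha(n+j) X^(d-j) *)
Definition jensenK (R : realType) (alpha : nat -> R) (d n : nat) : {poly R} :=
  \sum_(j < d.+1) ('C(d, j)%:R * alpha (n + j)%N) *: 'X^(d - j).

Definition complexify (R : realType) (p : {poly R}) : {poly R[i]} :=
  map_poly (fun x : R => (x%:C)%C) p.

Definition distinct_zeros (R : realType) (p : {poly R}) : Prop :=
  forall z : R[i], (mup z (complexify p) <= 1)%N.

Definition all_zeros_real (R : realType) (p : {poly R}) : Prop :=
  forall z : R[i], root (complexify p) z -> complex.Im z = 0.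

Definition zeros_nonreal_but_one_if_odd (R : realType) (d : nat) (p : {poly R}) : Prop :=
  if odd d then exists! z : R[i], root (complexify p) z /\ complex.Im z = 0
  else forall z : R[i], root (complexify p) z -> complex.Im z != 0.

(* Main.v *)
(** Put [c_n(j) = alpha(n+j) / alpha(n) * exp(-A(n) j)].  Up to the nonzero
    factor [alpha(n) delta(n)^d], substituting [exp(-A(n)) (delta(n) X - 1)] in
    [J^{d,n}] gives the polynomial whose [X^k]-coefficient is [binom(d,k)] times
    the (signed) finite difference of order [d-k] of [c_n] at [k], divided by
    [delta(n)^(d-k)].  Expanding [c_n(j) = exp(kappa delta^2 j^2 + ...)] in
    powers of [delta j], these differences converge to the numbers [h_r] with
    exponential generating function [exp(kappa t^2)], so the substituted
    polynomials converge coefficientwise to the Hermite-type polynomial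
    [H_d = sum_k binom(d,k) h_(d-k) X^k].  The hypothesis on finite differences is
    invariant under [j |-> d-j], which handles [K^{d,n}].

    What remains is that every real polynomial of degree at most [d] with
    coefficients close to those of [H_d] has zeros of the required kind.  They lie
    in a fixed disc.  They are simple because of a Bezout identity between [H_d]
    and [H_d' = d H_(d-1)].  For [kappa = -1] they are real because
    [Im z * Im (H_d(z) conj(H_(d-1)(z))) >= (Im z)^2].  For [kappa = 1] the
    even-indexed [H_d] are positive on the real line, which excludes real zeros
    for [d] even and, by Rolle, two real zeros for [d] odd. *)

Require Import Defs.
From HB Require Import structures.
From mathcomp Require Import all_boot all_order all_algebra.
From mathcomp Require Import all_classical all_reals all_analysis.
From mathcomp Require Import complex polyrcf ring lra zify.
Import Order.TTheory GRing.Theory Num.Theory.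
Import numFieldNormedType.Exports.
Import ComplexField.Normc.
Local Open Scope ring_scope.

(** * Hermite-type numbers and polynomials *)

(** With exponential generating function y = exp(kappa t^2), the recurrence is y' = 2 kappa t y read
    on coefficients. *)
Fixpoint hermite_number (R : realType) (kappa : R) (n : nat) : R :=
  match n with
  | 0 => 1
  | 1 => 0
  | k.+2 => 2 * kappa * k.+1%:R * hermite_number R kappa k
  end.
Arguments hermite_number {R} kappa n.

(** The exponential generating function is exp(X t + kappa t^2); for kappa = -1 this is the
    classical Hermite polynomial at X/2. *)
Definition hermite {R : realType} (kappa : R) (d : nat) : {poly R} :=
  \poly_(k < d.+1) ('C(d, k)%:R * hermite_number kappa (d - k)).

Lemma hermite_numberSS (R : realType) (kappa : R) (n : nat) :
  hermite_number kappa n.+2 = 2 * kappa * n.+1%:R * hermite_number kappa n.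
Proof. by []. Qed.

Lemma hermite_number_odd (R : realType) (kappa : R) (n : nat) :
  odd n -> hermite_number kappa n = 0.
Proof.
elim/ltn_ind: n => -[//|[//|n]] IH /=; rewrite negbK => on.
by rewrite IH ?mulr0.
Qed.

Lemma hermite_number_ge0 (R : realType) (n : nat) : 0 <= hermite_number (1 : R) n.
Proof.
elim/ltn_ind: n => -[|[|n]] IH //.
by rewrite hermite_numberSS !mulr_ge0// IH.
Qed.

Lemma hermite_number_gt0 (R : realType) (n : nat) :
  ~~ odd n -> 0 < hermite_number (1 : R) n.
Proof.
elim/ltn_ind: n => -[|[|n]] IH //; rewrite hermite_numberSS /= negbK => on.
by rewrite !mulr_gt0// IH.
Qed.

Lemma coef_hermite (R : realType) (kappa : R) (d k : nat) :
  (hermite kappa d)`_k = 'C(d, k)%:R * hermite_number kappa (d - k).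
Proof.
by rewrite coef_poly ltnS; case: leqP => // dk; rewrite bin_small// mul0r.
Qed.

Lemma hermite0 (R : realType) (kappa : R) : hermite kappa 0 = 1.
Proof.
apply/polyP => -[|i]; rewrite coef_hermite coef1 ?mul1r//.
by rewrite bin0n mul0r.
Qed.

Lemma hermite1 (R : realType) (kappa : R) : hermite kappa 1 = 'X.
Proof.
apply/polyP => -[|[|i]]; rewrite coef_hermite coefX ?mul1r ?mulr0//.
by rewrite bin_small// mul0r.
Qed.

Lemma hermiteSS (R : realType) (kappa : R) (d : nat) :
  hermite kappa d.+2 =
  'X * hermite kappa d.+1 + (2 * kappa * d.+1%:R) *: hermite kappa d.
Proof.
apply/polyP => -[|k].
  rewrite coefD coefXM coefZ !coef_hermite !bin0 !subn0 add0r hermite_numberSS.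
  by rewrite !mul1r.
rewrite coefD coefXM coefZ !coef_hermite /= binS natrD mulrDl addrC subSS.
congr (_ + _).
have [dk|dk|<-] := ltngtP d k; last 1 first.
- by rewrite binn subSn// subnn (@bin_small d)//= mul0r !mulr0.
- by rewrite !bin_small ?mul0r ?mulr0// ltnS// ltnW.
have -> : (d.+1 - k = (d - k.+1).+2)%N by lia.
rewrite hermite_numberSS.
(* Pascal's rule has already split off the ['X] term. What remains is this absorption identity,
   matched with the factor that [hermite_numberSS] releases. *)
have E : ('C(d.+1, k.+1))%:R * ((d - k.+1).+1)%:R = d.+1%:R * ('C(d, k.+1))%:R :> R.
  rewrite -!natrM; congr (_%:R).
  rewrite (mul_bin_down d.+1 k.+1) mulnC; congr (_ * _)%N; lia.
transitivity (2 * kappa * hermite_number kappa (d - k.+1) *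
  (('C(d.+1, k.+1))%:R * ((d - k.+1).+1)%:R)); first by ring.
by rewrite E; ring.
Qed.

Lemma deriv_hermite (R : realType) (kappa : R) (d : nat) :
  (hermite kappa d.+1)^`() = d.+1%:R *: hermite kappa d.
Proof.
apply/polyP => k; rewrite coef_deriv coefZ !coef_hermite subSS.
rewrite -mulrnAl -mulrnA mulrA; congr (_ * _).
rewrite -natrM; congr (_%:R); rewrite mulnC.
by rewrite (mul_bin_diag d.+1 k).
Qed.

(** Euclid's algorithm run backwards: the three-term recurrence writes a nonzero multiple of H_d as
    H_(d+2) - X H_(d+1), and kappa != 0 makes that multiple invertible. *)
Lemma hermite_bezout (R : realType) (kappa : R) (d : nat) : kappa != 0 ->
  exists u v : {poly R}, u * hermite kappa d.+1 + v * hermite kappa d = 1.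
Proof.
move=> k0; elim: d => [|d [u [v uv]]].
  by exists 0, 1; rewrite hermite0 mul0r mulr1 add0r.
set c := 2 * kappa * d.+1%:R.
have c0 : c != 0 by rewrite !mulf_neq0.
have cV : c^-1%:P * c%:P = 1 :> {poly R} by rewrite -polyCM mulVf.
exists (c^-1%:P * v), (u - c^-1%:P * ('X * v)).
rewrite hermiteSS -/c -[RHS]uv -mul_polyC.
transitivity (u * hermite kappa d.+1 + (c^-1%:P * c%:P) * (v * hermite kappa d)).
  by ring.
by rewrite cV mul1r.
Qed.

(** For even d only even powers of x occur, all with nonnegative coefficients, so the constant term
    is a lower bound. *)
Lemma hermite_ge (R : realType) (d : nat) (x : R) : ~~ odd d ->
  hermite_number 1 d <= (hermite 1 d).[x].
Proof.
move=> od; rewrite horner_poly big_ord_recl /= bin0 subn0 expr0 mul1r mulr1.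
rewrite lerDl sumr_ge0// => i _.
have le_id : (bump 0 i <= d)%N by rewrite /bump leq0n add1n ltn_ord.
case: (boolP (odd (bump 0 i))) => oi.
  by rewrite hermite_number_odd ?mulr0 ?mul0r// oddB// (negbTE od) oi.
by rewrite !mulr_ge0// ?hermite_number_ge0// exprn_even_ge0.
Qed.

(** * Real polynomials at complex points, with estimates on a disc *)

Lemma horner_complexify_real (R : realType) (p : {poly R}) (x : R) :
  (complexify p).[(x%:C)%C] = ((p.[x])%:C)%C.
Proof. exact: (horner_map (real_complex R)). Qed.

Lemma complexifyD (R : realType) (p q : {poly R}) :
  complexify (p + q) = complexify p + complexify q.
Proof. exact: (rmorphD (map_poly (real_complex R))). Qed.

Lemma complexifyB (R : realType) (p q : {poly R}) :
  complexify (p - q) = complexify p - complexify q.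
Proof. exact: (rmorphB (map_poly (real_complex R))). Qed.

Lemma complexifyM (R : realType) (p q : {poly R}) :
  complexify (p * q) = complexify p * complexify q.
Proof. exact: (rmorphM (map_poly (real_complex R))). Qed.

Lemma complexifyZ (R : realType) (a : R) (p : {poly R}) :
  complexify (a *: p) = (a%:C)%C *: complexify p.
Proof. exact: (map_polyZ (real_complex R)). Qed.

Lemma complexifyX (R : realType) : complexify ('X : {poly R}) = 'X.
Proof. exact: (map_polyX (real_complex R)). Qed.

Lemma complexify1 (R : realType) : complexify (1 : {poly R}) = 1.
Proof. exact: (rmorph1 (map_poly (real_complex R))). Qed.

Lemma complexify_deriv (R : realType) (p : {poly R}) :
  (complexify p)^`() = complexify p^`().
Proof. exact: (deriv_map (real_complex R)). Qed.

Lemma complexify_comp (R : realType) (p q : {poly R}) :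
  complexify (p \Po q) = complexify p \Po complexify q.
Proof. exact: (map_comp_poly (real_complex R)). Qed.

Lemma horner_complexify_wide (R : realType) (n : nat) (p : {poly R}) (z : R[i]) :
  (size p <= n)%N ->
  (complexify p).[z] = \sum_(i < n) ((p`_i)%:C)%C * z ^+ i.
Proof.
move=> sp; rewrite (@horner_coef_wide _ n); last first.
  by rewrite (leq_trans (size_poly _ _)).
by apply: eq_bigr => i _; rewrite (coef_map (real_complex R)).
Qed.

Lemma normcX (R : realType) (z : R[i]) (n : nat) : normc (z ^+ n) = normc z ^+ n.
Proof.
elim: n => [|n IH]; first by rewrite !expr0 -normc1.
by rewrite !exprS normcM IH.
Qed.

Lemma normc_realC (R : realType) (x : R) : normc (x%:C)%C = `|x|.
Proof. by rewrite /= expr0n addr0 sqrtr_sqr. Qed.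

Lemma normc_nonneg (R : realType) (z : R[i]) : 0 <= normc z.
Proof. by case: z => a b; apply: sqrtr_ge0. Qed.

Lemma ler_normc_sum (R : realType) (n : nat) (F : 'I_n -> R[i]) :
  normc (\sum_i F i) <= \sum_i normc (F i).
Proof.
elim/big_ind2: _ => [|a b c e ab ce|//]; first by rewrite normc0.
by rewrite (le_trans (le_normcD _ _))// lerD.
Qed.

Lemma normc_ge_absRe (R : realType) (z : R[i]) : `|complex.Re z| <= normc z.
Proof.
by case: z => a b /=; rewrite -sqrtr_sqr ler_wsqrtr// lerDl sqr_ge0.
Qed.

Lemma Im_mulc (R : realType) (u v : R[i]) :
  complex.Im (u * v) = complex.Re u * complex.Im v + complex.Im u * complex.Re v.
Proof. by case: u => a b; case: v => c d. Qed.

(** The factor |Im z| is essential: the reality argument needs perturbation errors that vanish as z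
    approaches the real axis. *)
Lemma ler_Im_exp (R : realType) (B : R) (z : R[i]) (n : nat) : 1 <= B ->
  normc z <= B -> `|complex.Im (z ^+ n)| <= n%:R * B ^+ n * `|complex.Im z|.
Proof.
move=> B1 zB; elim: n => [|n IH]; first by rewrite expr0 mulr0n !mul0r normr0.
have B0 : 0 <= B by lra.
rewrite exprS Im_mulc (le_trans (ler_normD _ _))// !normrM.
have h1 : `|complex.Re z| * `|complex.Im (z ^+ n)| <=
    B * (n%:R * B ^+ n * `|complex.Im z|).
  by rewrite ler_pM// (le_trans (normc_ge_absRe _ _)).
have h2 : `|complex.Im z| * `|complex.Re (z ^+ n)| <= `|complex.Im z| * B ^+ n.+1.
  rewrite ler_wpM2l// (le_trans (normc_ge_absRe _ _))// normcX.
  rewrite (@le_trans _ _ (B ^+ n))//; first by rewrite lerXn2r// ?nnegrE ?normc_nonneg.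
  by rewrite ler_weXn2l.
rewrite (le_trans (lerD h1 h2))// exprS -natr1.
by rewrite le_eqVlt; apply/orP; left; apply/eqP; ring.
Qed.

Lemma ler_normc_complexify (R : realType) (n : nat) (B e : R) (p : {poly R})
    (z : R[i]) :
  1 <= B -> (size p <= n)%N -> (forall i, `|p`_i| <= e) -> normc z <= B ->
  normc (complexify p).[z] <= n%:R * (e * B ^+ n).
Proof.
move=> B1 sp pe zB; rewrite (horner_complexify_wide _ _ _ _ sp).
rewrite (le_trans (ler_normc_sum _ _ _))//.
have -> : n%:R * (e * B ^+ n) = \sum_(i < n) (e * B ^+ n).
  by rewrite sumr_const card_ord mulr_natl.
apply: ler_sum => i _; rewrite normcM normc_realC normcX ler_pM// ?exprn_ge0 ?normc_nonneg//.
rewrite (@le_trans _ _ (B ^+ i))//; first by rewrite lerXn2r// ?nnegrE ?normc_nonneg//; lra.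
by rewrite ler_weXn2l// ltnW.
Qed.

Lemma ler_Im_complexify (R : realType) (n : nat) (B e : R) (p : {poly R})
    (z : R[i]) :
  1 <= B -> (size p <= n)%N -> (forall i, `|p`_i| <= e) -> normc z <= B ->
  `|complex.Im (complexify p).[z]| <= n%:R ^+ 2 * B ^+ n * e * `|complex.Im z|.
Proof.
move=> B1 sp pe zB; rewrite (horner_complexify_wide _ _ _ _ sp).
have -> : complex.Im (\sum_(i < n) ((p`_i)%:C)%C * z ^+ i) =
    \sum_(i < n) p`_i * complex.Im (z ^+ i).
  apply: (big_ind2 (fun w x => complex.Im w = x)) => [//|[? ?] ? [? ?] ? <- <- //|i _].
  by rewrite Im_mulc /= mul0r addr0.
rewrite (le_trans (ler_norm_sum _ _ _))//.
have -> : n%:R ^+ 2 * B ^+ n * e * `|complex.Im z| =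
    \sum_(i < n) (e * (n%:R * B ^+ n * `|complex.Im z|)).
  by rewrite sumr_const card_ord -[RHS]mulr_natl; ring.
apply: ler_sum => i _; rewrite normrM ler_pM//.
rewrite (le_trans (ler_Im_exp _ B _ _ B1 zB))//.
rewrite ler_wpM2r// ler_pM// ?ler_nat ?exprn_ge0 ?ler_weXn2l//; try lra.
- by rewrite ltnW.
- by rewrite ltnW.
Qed.

(** One constant serves all three estimates: values cost a factor n, and differentiation enlarges
    the coefficients by at most another n. *)
Lemma ler_complexify (R : realType) (n : nat) (B e : R) (p : {poly R}) (z : R[i]) :
  1 <= B -> (size p <= n)%N -> (forall i, `|p`_i| <= e) -> normc z <= B ->
  [/\ normc (complexify p).[z] <= n%:R ^+ 2 * B ^+ n * e,
      normc (complexify p^`()).[z] <= n%:R ^+ 2 * B ^+ n * e &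
      `|complex.Im (complexify p).[z]| <= n%:R ^+ 2 * B ^+ n * e * `|complex.Im z|].
Proof.
move=> B1 sp pe zB.
have e0 : 0 <= e by apply: le_trans (pe 0%N).
have nn : n%:R <= n%:R ^+ 2 :> R by rewrite -natrX ler_nat; nia.
have B0 : 0 <= B ^+ n by rewrite exprn_ge0//; lra.
split; last exact: ler_Im_complexify.
  rewrite (le_trans (ler_normc_complexify _ _ _ _ _ _ B1 sp pe zB))//.
  by rewrite mulrAC mulrA ler_wpM2r// ler_wpM2r.
have sp' : (size p^`() <= n)%N.
  by rewrite (leq_trans (size_poly _ _))// (leq_trans (leq_pred _)).
have pe' i : `|p^`()`_i| <= n%:R * e.
  rewrite coef_deriv; have [ni|ni] := leqP n i.+1.
    by rewrite nth_default ?(leq_trans sp)// mul0rn normr0 mulr_ge0.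
  by rewrite normrMn -[_ *+ i.+1]mulr_natl ler_pM// ler_nat ltnW.
rewrite (le_trans (ler_normc_complexify _ _ _ _ _ _ B1 sp' pe' zB))//.
by rewrite le_eqVlt; apply/orP; left; apply/eqP; ring.
Qed.

Lemma ler_complexify_ex (R : realType) (B : R) (p : {poly R}) : 1 <= B ->
  exists2 C, 0 <= C & forall z, normc z <= B ->
    normc (complexify p).[z] <= C /\
    `|complex.Im (complexify p).[z]| <= C * `|complex.Im z|.
Proof.
move=> B1; set e := \sum_(i < size p) `|p`_i|.
have pe i : `|p`_i| <= e.
  have [si|si] := leqP (size p) i.
    by rewrite nth_default// normr0 sumr_ge0.
  by rewrite /e (bigD1 (Ordinal si))//= lerDl sumr_ge0.
exists ((size p)%:R ^+ 2 * B ^+ size p * e).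
  by rewrite !mulr_ge0// ?exprn_ge0 ?sumr_ge0//; lra.
by move=> z zB; have [] := ler_complexify _ _ _ _ _ _ B1 (leqnn _) pe zB.
Qed.

(** Cauchy's bound: outside the disc the top term, whose coefficient is at least 1/2 in absolute
    value, dominates the sum of the others. *)
Lemma root_complexify_bound (R : realType) (n : nat) (M : R) (p : {poly R}) (z : R[i]) :
  (size p <= n.+1)%N -> (forall i, `|p`_i| <= M) -> 1 <= 2 * `|p`_n| ->
  root (complexify p) z -> normc z <= 1 + 2 * n%:R * M.
Proof.
move=> sp pM p1 /eqP; rewrite (horner_complexify_wide _ _ _ _ sp) big_ord_recr /=.
have M0 : 0 <= M by apply: le_trans (pM 0%N).
move=> /eqP; rewrite addrC addr_eq0 => /eqP E.
rewrite leNgt; apply/negP => zM.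
have z1 : 1 < normc z by rewrite (le_lt_trans _ zM)// lerDl !mulr_ge0.
(* For n = 0 the root equation makes the constant coefficient vanish, against its lower bound. *)
case: n => [|n] in sp pM p1 E zM *.
  move: E; rewrite expr0 big_ord0 oppr0 mulr1 => /(congr1 (@normc R)).
  by rewrite normc_realC normc0 => E0; move: p1; rewrite E0; lra.
have zn : 0 < normc z ^+ n by rewrite exprn_gt0//; lra.
have : `|p`_n.+1| * normc z ^+ n.+1 <= n.+1%:R * (M * normc z ^+ n).
  rewrite -normcX -normc_realC -normcM E normcN (le_trans (ler_normc_sum _ _ _))//.
  have -> : n.+1%:R * (M * normc z ^+ n) = \sum_(i < n.+1) (M * normc z ^+ n).
    by rewrite sumr_const card_ord mulr_natl.
  apply: ler_sum => i _; rewrite normcM normc_realC normcX ler_pM// ?exprn_ge0 ?normc_nonneg//.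
  by rewrite ler_weXn2l// ?ltW// -ltnS.
rewrite exprS !mulrA ler_pM2r// => h.
have : normc z <= 2 * (`|p`_n.+1| * normc z).
  by rewrite mulrA ler_peMl// ltW// (lt_trans _ z1).
move: zM h; set t := n.+1%:R * M; rewrite -!mulrA -/t; lra.
Qed.

(** * Simple zeros *)

Lemma mup_gt1_root (F : fieldType) (p : {poly F}) (z : F) :
  p != 0 -> (1 < mup z p)%N -> root p z /\ root p^`() z.
Proof.
move=> p0; rewrite mup_geq// => /dvdpP [q ->].
rewrite -!dvdp_XsubCl expr2 !derivM derivXsubC mul1r mulr1.
by rewrite dvdp_add// !dvdp_mull// dvdp_add.
Qed.

(** Avoiding common zeros of p and p' excludes p = 0 and passes easily through perturbations and
    affine substitutions, unlike multiplicities. *)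
Definition simple_zeros {R : realType} (p : {poly R}) : Prop :=
  forall z, root (complexify p) z -> root (complexify p^`()) z -> False.

Lemma simple_zeros_distinct (R : realType) (p : {poly R}) :
  simple_zeros p -> distinct_zeros p.
Proof.
move=> pz z; rewrite leqNgt; apply/negP => mz.
have p0 : complexify p != 0.
  apply/eqP => p0; apply: (pz 0); first by rewrite p0 root0.
  by rewrite -complexify_deriv p0 linear0 root0.
have [rz] := mup_gt1_root _ _ _ p0 mz.
by rewrite complexify_deriv; apply: pz.
Qed.

Lemma complexify_hermiteSS (R : realType) (kappa : R) (d : nat) (z : R[i]) :
  (complexify (hermite kappa d.+2)).[z] = z * (complexify (hermite kappa d.+1)).[z] +
    ((2 * kappa * d.+1%:R)%:C)%C * (complexify (hermite kappa d)).[z].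
Proof.
by rewrite hermiteSS complexifyD complexifyM complexifyX complexifyZ !hornerE.
Qed.

(* Im (H_(d+1)(z) conj(H_d(z))) satisfies a one-step recurrence: this is
   Christoffel-Darboux at the points z and conj z. *)
Lemma Im_hermite_conj (R : realType) (d : nat) (z : R[i]) :
  complex.Im z ^+ 2 <= complex.Im z * complex.Im
    ((complexify (hermite (-1) d.+1)).[z] *
     ((complexify (hermite (-1) d)).[z])^*)%C.
Proof.
elim: d => [|d IH].
  rewrite hermite0 hermite1 complexifyX complexify1 !hornerE /=.
  by case: z => a b /=; rewrite oppr0 mulr0 mulr1 add0r expr2.
rewrite complexify_hermiteSS; move: IH.
case: (complexify (hermite (-1) d)).[z] => a b.
case: (complexify (hermite (-1) d.+1)).[z] => c e.
case: z => x y /= IH.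
have d1 : 1 <= d.+1%:R :> R by rewrite ler1n.
set D := d.+1%:R in d1 *.
(* By the recurrence, y Im(H_(d+2) conj(H_(d+1))) is y^2 |H_(d+1)|^2, nonnegative by [h1], plus 2D y
   Im(H_(d+1) conj(H_d)), which [h2] bounds below by y^2. *)
have h1 : 0 <= (y * c) ^+ 2 + (y * e) ^+ 2 by rewrite addr_ge0 ?sqr_ge0.
have h2 : y ^+ 2 <= 2 * D * (y * (c * - b + e * a)).
  apply: (le_trans IH); rewrite ler_peMl//; last lra.
  by apply: le_trans IH; rewrite sqr_ge0.
nra.
Qed.

(** * Stability of the zeros of H_d under small changes of coefficients *)

(** In the perturbation arguments [e <= 2^-1] keeps the top coefficient away from zero, and
    [T * e < 1] yields the final contradiction. *)
Lemma exists_small (R : realType) (T : R) : 0 <= T ->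
  exists2 e, 0 < e & e <= 2^-1 /\ T * e < 1.
Proof.
move=> T0; have T2 : 0 < 2 + T by lra.
exists (2 + T)^-1; first by rewrite invr_gt0.
by rewrite lef_pV2 ?posrE// ltr_pdivrMr// mul1r; split; lra.
Qed.

Lemma hermite_close_root_bound (R : realType) (kappa : R) (d : nat) :
  exists2 B : R, 1 <= B & forall (e : R) (Q : {poly R}), e <= 2^-1 ->
    (size Q <= d.+1)%N -> (forall i, `|(Q - hermite kappa d)`_i| <= e) ->
    forall z, root (complexify Q) z -> normc z <= B.
Proof.
(* The summand 1 absorbs the perturbation, so the resulting radius does not depend on [Q] or [e]. *)
set M := 1 + \sum_(i < d.+1) `|(hermite kappa d)`_i|.
have M0 : 0 <= M by rewrite addr_ge0 ?sumr_ge0.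
exists (1 + 2 * d%:R * M); first by rewrite lerDl !mulr_ge0.
move=> e Q e12 sQ Qe z rz; apply: root_complexify_bound rz => //.
  move=> i; have := Qe i; rewrite coefB.
  have hi : `|(hermite kappa d)`_i| <= M - 1.
    rewrite addrC addKr; have [si|si] := leqP d.+1 i.
      by rewrite nth_default ?(leq_trans (size_poly _ _))// normr0 sumr_ge0.
    by rewrite (bigD1 (Ordinal si))//= lerDl sumr_ge0.
  have := ler_normD (Q`_i - (hermite kappa d)`_i) (hermite kappa d)`_i.
  rewrite subrK; lra.
have := Qe d; rewrite coefB coef_hermite binn subnn mul1r /=.
have := ler_normB Q`_d (Q`_d - 1); rewrite subKr normr1; lra.
Qed.

(** At a common zero of Q and Q', both H_(d+1) and H_(d+1)' = (d+1) H_d have modulus at most K e.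
    The Bezout identity then gives 1 <= (Cu + Cv) K e < 1. *)
Lemma hermite_close_simple (R : realType) (kappa : R) (d : nat) : kappa != 0 ->
  exists2 e : R, 0 < e & forall Q : {poly R}, (size Q <= d.+2)%N ->
    (forall i, `|(Q - hermite kappa d.+1)`_i| <= e) -> simple_zeros Q.
Proof.
move=> k0; have [B B1 QB] := hermite_close_root_bound R kappa d.+1.
have [u [v uv]] := hermite_bezout R kappa d k0.
have [Cu Cu0 uC] := ler_complexify_ex R B u B1.
have [Cv Cv0 vC] := ler_complexify_ex R B v B1.
set K := d.+2%:R ^+ 2 * B ^+ d.+2 : R.
have K0 : 0 <= K by rewrite mulr_ge0// exprn_ge0//; lra.
have [] := exists_small R ((Cu + Cv) * K); first by rewrite mulr_ge0 ?addr_ge0.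
move=> e e0 [e12 eT]; exists e => // Q sQ Qe.
move=> z rz rz'; have zB := QB _ _ e12 sQ Qe _ rz.
have sE : (size (Q - hermite kappa d.+1)%R <= d.+2)%N.
  by rewrite (leq_trans (size_polyD _ _))// size_polyN geq_max sQ size_poly.
have [hE hE' _] := ler_complexify _ _ _ _ _ _ B1 sE Qe zB.
move: hE hE'; rewrite -/K derivB !complexifyB !hornerD !hornerN (eqP rz) (eqP rz').
rewrite !sub0r !normcN deriv_hermite complexifyZ hornerZ normcM normc_realC.
set H := (complexify _).[z]; set G := (complexify (hermite kappa d)).[z].
move=> hH hG'.
have hG : normc G <= K * e.
  apply: le_trans hG'; rewrite ger0_norm// ler_peMl ?normc_nonneg//.
  by rewrite ler1n.
have := congr1 (fun p => (complexify p).[z]) uv.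
rewrite /= complexifyD !complexifyM complexify1 !hornerE -/H -/G.
move=> /(congr1 (@normc R)); rewrite normc1 => E.
have := le_normcD ((complexify u).[z] * H) ((complexify v).[z] * G).
rewrite E !normcM.
have := ler_pM (normc_nonneg _ _) (normc_nonneg _ _) (uC z zB).1 hH.
have := ler_pM (normc_nonneg _ _) (normc_nonneg _ _) (vC z zB).1 hG.
move: eT; rewrite mulrDl mulrDl !mulrA; lra.
Qed.

(** At a zero z of Q with y = Im z, the value H of H_(d+1) satisfies |H| <= K e and |Im H| <= K e
    |y|, while G = H_d(z) satisfies such bounds with C. Hence |Im(H conj(G))| <= 2 C K e |y|, which
    is below |y| when y != 0 and contradicts [Im_hermite_conj]. *)
Lemma hermite_close_real (R : realType) (d : nat) :
  exists2 e : R, 0 < e & forall Q : {poly R}, (size Q <= d.+2)%N ->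
    (forall i, `|(Q - hermite (-1) d.+1)`_i| <= e) -> all_zeros_real Q.
Proof.
have [B B1 QB] := hermite_close_root_bound R (-1) d.+1.
have [C C0 GC] := ler_complexify_ex R B (hermite (-1) d) B1.
set K := d.+2%:R ^+ 2 * B ^+ d.+2 : R.
have K0 : 0 <= K by rewrite mulr_ge0// exprn_ge0//; lra.
have [] := exists_small R (2 * C * K); first by rewrite mulr_ge0// mulr_ge0.
move=> e e0 [e12 eT]; exists e => // Q sQ Qe z rz.
have zB := QB _ _ e12 sQ Qe _ rz.
have sE : (size (Q - hermite (-1) d.+1)%R <= d.+2)%N.
  by rewrite (leq_trans (size_polyD _ _))// size_polyN geq_max sQ size_poly.
have [hE _ hE'] := ler_complexify _ _ _ _ _ _ B1 sE Qe zB.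
have [hG hG'] := GC z zB.
have := Im_hermite_conj R d z.
move: hE hE' hG hG'; rewrite -/K complexifyB hornerD hornerN (eqP rz) sub0r normcN.
set H := (complexify (hermite _ d.+1)).[z].
set G := (complexify (hermite _ d)).[z].
set y := complex.Im z.
have -> : complex.Im (- H) = - complex.Im H by case: (H).
rewrite normrN => hE hE' hG hG' hy; apply/eqP/negPn/negP => y0.
have hI : `|complex.Im (H * G^*)%C| <= (2 * C * K) * e * `|y|.
  rewrite Im_mulc.
  have -> : complex.Im (G^*)%C = - complex.Im G by case: (G).
  have -> : complex.Re (G^*)%C = complex.Re G by case: (G).
  rewrite mulrN (le_trans (ler_normD _ _))// normrN !normrM.
  have := ler_pM (normr_ge0 _) (normr_ge0 _) (le_trans (normc_ge_absRe _ H) hE) hG'.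
  have := ler_pM (normr_ge0 _) (normr_ge0 _) hE' (le_trans (normc_ge_absRe _ G) hG).
  nra.
have y0' : 0 < `|y| by rewrite normr_gt0.
have : `|y| ^+ 2 <= `|y| * `|complex.Im (H * G^*)%C|.
  by rewrite real_normK ?num_real// -normrM (le_trans hy)// ler_norm.
have : `|y| * `|complex.Im (H * G^*)%C| < `|y| ^+ 2.
  by rewrite expr2 ltr_pM2l// (le_lt_trans hI)// gtr_pMl.
lra.
Qed.

Lemma hermite_close_nonreal (R : realType) (d : nat) :
  exists2 e : R, 0 < e & forall Q : {poly R}, (size Q <= d.+2)%N ->
    (forall i, `|(Q - hermite 1 d.+1)`_i| <= e) ->
    zeros_nonreal_but_one_if_odd d.+1 Q.
Proof.
have [B B1 QB] := hermite_close_root_bound R 1 d.+1.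
set K := d.+2%:R ^+ 2 * B ^+ d.+2 : R.
have K0 : 0 <= K by rewrite mulr_ge0// exprn_ge0//; lra.
have close_real (e : R) (Q : {poly R}) (x : R) : (size Q <= d.+2)%N ->
    (forall i, `|(Q - hermite 1 d.+1)`_i| <= e) -> `|x| <= B ->
    `|Q.[x] - (hermite 1 d.+1).[x]| <= K * e /\
    `|Q^`().[x] - d.+1%:R * (hermite 1 d).[x]| <= K * e.
  move=> sQ Qe xB; have zB : normc (x%:C)%C <= B by rewrite normc_realC.
  have sE : (size (Q - hermite 1 d.+1)%R <= d.+2)%N.
    by rewrite (leq_trans (size_polyD _ _))// size_polyN geq_max sQ size_poly.
  have [hE hE' _] := ler_complexify _ _ _ _ _ _ B1 sE Qe zB.
  move: hE hE'; rewrite !horner_complexify_real !normc_realC derivB deriv_hermite.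
  by rewrite -/K !hornerD !hornerN hornerZ.
(* The degree is [d.+1], so odd [d] is the case of even degree: a real zero of Q would force the
   positive minimum of H_(d+1) below K e. *)
case: (boolP (odd d)) => od.
  set h := hermite_number (1 : R) d.+1.
  have h0 : 0 < h by apply: hermite_number_gt0; rewrite /= od.
  have [] := exists_small R (K / h); first by rewrite divr_ge0// ltW.
  move=> e e0 [e12 eT]; exists e => // Q sQ Qe.
  rewrite /zeros_nonreal_but_one_if_odd /= od /= => z rz; apply/eqP => z0.
  have zE : z = ((complex.Re z)%:C)%C by case: z z0 {rz} => a b /= ->.
  have zB := QB _ _ e12 sQ Qe _ rz.
  move: rz zB; rewrite zE rootE horner_complexify_real normc_realC.
  move=> /eqP[Q0] xB; have [+ _] := close_real _ _ _ sQ Qe xB.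
  rewrite Q0 sub0r normrN => hK.
  have hh : h <= K * e.
    by apply: le_trans (le_trans (ler_norm _) hK); apply: hermite_ge; rewrite /= od.
  by move: eT; rewrite mulrAC ltr_pdivrMr// mul1r; lra.
set h := hermite_number (1 : R) d.
have h0 : 0 < h by apply: hermite_number_gt0.
have [] := exists_small R (K / h); first by rewrite divr_ge0// ltW.
move=> e e0 [e12 eT]; exists e => // Q sQ Qe.
rewrite /zeros_nonreal_but_one_if_odd /= od.
(* The top coefficient is within 1/2 of 1, so Q has exactly the odd degree [d.+1] and therefore a
   real zero. *)
have sQE : size Q = d.+2.
  apply/eqP; rewrite eqn_leq sQ /= ltnNge; apply/negP => sQ'.
  have := Qe d.+1; rewrite coefB coef_hermite binn subnn mul1r nth_default//.
  by rewrite sub0r normrN normr1; lra.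
have [x0 rx0] : {x | root Q x} by apply: odd_poly_root; rewrite sQE /= negbK.
have rooted x : root Q x -> `|x| <= B.
  move=> rx; rewrite -normc_realC; apply: (QB _ _ e12 sQ Qe).
  by rewrite rootE horner_complexify_real (eqP rx).
have no_two x y : x < y -> root Q x -> root Q y -> False.
  move=> xy rx ry; have [] := poly_rolle xy (p := Q); first by rewrite (eqP rx) (eqP ry).
  move=> c; rewrite in_itv /= => /andP[xc cy] Q'c.
  (* The critical point given by Rolle lies between two zeros of Q, hence inside the disc where Q'
     is controlled by (d+1) H_d. *)
  have cB : `|c| <= B.
    have := rooted _ rx; have := rooted _ ry; rewrite !ler_norml.
    by move=> /andP[? ?] /andP[? ?]; apply/andP; split; lra.
  have [_] := close_real _ _ _ sQ Qe cB; rewrite Q'c sub0r normrN => hK.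
  have hh := hermite_ge R d c od.
  have : h <= K * e.
    apply: le_trans hK; apply: le_trans (ler_norm _).
    by rewrite (le_trans hh)// ler_peMl ?ler1n//; apply: le_trans hh; rewrite -/h ltW.
  by move: eT; rewrite mulrAC ltr_pdivrMr// mul1r; lra.
exists (x0%:C)%C; split.
  by rewrite rootE horner_complexify_real (eqP rx0).
move=> [a b] [+ /= b0]; rewrite b0 rootE -[(_ +i* _)%C]/(a%:C)%C horner_complexify_real.
move=> /eqP[ra]; congr (_%:C)%C; apply/eqP; case: ltgtP => // ne.
- by case: (no_two _ _ ne rx0 _); apply/eqP.
- by case: (no_two _ _ ne _ rx0); apply/eqP.
Qed.

Definition hermite_like (R : realType) (kappa : R) (d : nat) (P : {poly R}) :=
  simple_zeros P /\ (kappa = -1 -> all_zeros_real P) /\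
  (kappa = 1 -> zeros_nonreal_but_one_if_odd d P).

Lemma hermite_like_close (R : realType) (kappa : R) (d : nat) :
  (1 <= d)%N -> kappa = 1 \/ kappa = -1 ->
  exists2 e : R, 0 < e & forall Q : {poly R}, (size Q <= d.+1)%N ->
    (forall i, `|(Q - hermite kappa d)`_i| <= e) -> hermite_like R kappa d Q.
Proof.
case: d => // d _ kE.
have k0 : kappa != 0 by case: kE => ->; rewrite ?oppr_eq0 oner_eq0.
have [e1 e10 H1] := hermite_close_simple R kappa d k0.
have [e2 e20 H2] := hermite_close_real R d.
have [e3 e30 H3] := hermite_close_nonreal R d.
exists (Num.min e1 (Num.min e2 e3)); first by rewrite !lt_min e10 e20.
move=> Q sQ Qe.
have Qe' i : [/\ `|(Q - hermite kappa d.+1)`_i| <= e1,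
    `|(Q - hermite kappa d.+1)`_i| <= e2 & `|(Q - hermite kappa d.+1)`_i| <= e3].
  by have := Qe i; rewrite !le_min => /and3P.
split; first by apply: H1 => // i; case: (Qe' i).
split=> kk; rewrite kk in Qe'; [apply: H2|apply: H3] => // i; by case: (Qe' i).
Qed.

(** * Taylor remainder of the exponential, and limits of sequences *)

Local Open Scope classical_set_scope.

Definition exp_poly {R : realType} (n : nat) : {poly R} := \poly_(i < n) (i`!%:R)^-1.

Lemma deriv_exp_poly (R : realType) (n : nat) :
  deriv (exp_poly n.+1) = exp_poly n :> {poly R}.
Proof.
apply/polyP => i; rewrite coef_deriv !coef_poly ltnS; case: ifP => _; last by rewrite mul0rn.
by rewrite factS natrM invfM -[LHS]mulr_natl mulrA mulfV// mul1r.
Qed.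

(** The derivative of each remainder is the previous remainder, so the mean value theorem gains one
    factor |x| per induction step. The crude constant e is enough for little-o purposes. *)
Lemma expR_sub_exp_poly (R : realType) (n : nat) (x : R) : `|x| <= 1 ->
  `|expR x - (exp_poly n).[x]| <= expR 1 * `|x| ^+ n.
Proof.
elim: n x => [|n IH] x x1.
  rewrite expr0 mulr1 /exp_poly poly_def big_ord0 horner0 subr0 ger0_norm ?expR_ge0//.
  by rewrite ler_expR; move: x1; rewrite ler_norml => /andP[].
pose f := fun y : R => expR y - (exp_poly n.+1).[y].
pose df := fun y : R => expR y - (exp_poly n).[y].
have f' (y : R) : is_derive y 1 f (df y).
  apply: is_deriveB.
  apply: DeriveDef; first exact: derivable_horner.
  by rewrite -derive1E -derivE deriv_exp_poly.
have cf a b : {within `[a, b], continuous f}.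
  by apply: derivable_within_continuous => y _; apply: ex_derive.
have f0 : f 0 = 0.
  rewrite /f expR0 horner_coef0 coef_poly /= invr1 subrr//.
have -> : expR x - (exp_poly n.+1).[x] = f x by [].
have [c cx fx] : exists2 c, `|c| <= `|x| & f x = df c * x.
  have [x0|x0] := leP 0 x.
    have [c] := MVT_segment x0 (fun y _ => f' y) (cf 0 x).
    rewrite in_itv /= => /andP[c0 cx]; rewrite f0 !subr0 => E; exists c => //.
    by rewrite !ger0_norm//.
  have [c] := MVT_segment (ltW x0) (fun y _ => f' y) (cf x 0).
  rewrite in_itv /= => /andP[c0 cx]; rewrite f0 !sub0r => E; exists c => //.
    by rewrite !ler0_norm ?lerN2// ltW.
  by apply: oppr_inj; rewrite E mulrN.
rewrite fx normrM exprSr mulrA ler_wpM2r//.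
apply: le_trans (IH c (le_trans cx x1)) _.
by rewrite ler_wpM2l ?expR_ge0// lerXn2r// nnegrE.
Qed.

Lemma cvgn_ext (R : realType) (u v : nat -> R) (a b : R) :
  u =1 v -> a = b -> u @ \oo --> a -> v @ \oo --> b.
Proof. by move=> /funext -> ->. Qed.

Lemma cvgn_exp (R : realType) (u : nat -> R) (a : R) (k : nat) :
  u @ \oo --> a -> (fun n => u n ^+ k) @ \oo --> a ^+ k.
Proof.
move=> ua; elim: k => [|k IH].
  by apply: (@cvgn_ext _ (fun=> 1) _ 1) (cvg_cst _) => // n; rewrite expr0.
apply: (@cvgn_ext _ (fun n => u n * u n ^+ k) _ (a * a ^+ k)) (cvgM ua IH) => [n|].
  by rewrite exprS.
by rewrite exprS.
Qed.

Lemma cvgn_sum (R : realType) (I : Type) (r : seq I) (u : I -> nat -> R) (a : I -> R) :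
  (forall i, u i @ \oo --> a i) ->
  (fun n => \sum_(i <- r) u i n) @ \oo --> \sum_(i <- r) a i.
Proof.
move=> ua; elim: r => [|i r IH].
  apply: (@cvgn_ext _ (fun=> 0) _ 0) (cvg_cst _) => [n|]; by rewrite big_nil.
apply: (@cvgn_ext _ (fun n => u i n + \sum_(j <- r) u j n) _ (a i + \sum_(j <- r) a j))
  (cvgD (ua i) IH) => [n|]; by rewrite big_cons.
Qed.

Lemma cvgn_abs_le (R : realType) (u v : nat -> R) :
  (exists N, forall n, (N <= n)%N -> `|u n| <= v n) ->
  v @ \oo --> (0 : R) -> u @ \oo --> (0 : R).
Proof.
move=> [N uv] v0; apply: norm_cvg0.
apply: (squeeze_cvgr _ (cvg_cst 0) v0).
by exists N => // n /= Nn; rewrite normr_ge0 uv.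
Qed.

Lemma little_o_cvg (R : realType) (f g : nat -> R) :
  (forall n, 0 < g n) -> little_o f g -> (fun n => f n / g n) @ \oo --> (0 : R).
Proof.
move=> g0 fg; apply/cvgr0Pnorm_le => e e0; have [N Nfg] := fg e e0.
exists N => // n /= Nn; rewrite normrM normfV ler_pdivrMr ?normr_gt0 ?gt_eqF//.
exact: Nfg.
Qed.

Lemma cvgn_eventually (R : realType) (u : nat -> R) (a e : R) : 0 < e ->
  u @ \oo --> a -> exists N, forall n, (N <= n)%N -> `|u n - a| <= e.
Proof.
move=> e0 /cvgrPdist_le /(_ e e0) [N _ H]; exists N => n Nn.
by rewrite distrC; apply: H.
Qed.

(** * Finite differences *)

(** This is (-1)^r times the usual forward difference; the sign will not matter, as the limits h_r
    vanish for odd r. *)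
Definition fdiff {R : realType} (r k : nat) (f : nat -> R) : R :=
  \sum_(i < r.+1) (-1) ^+ i * 'C(r, i)%:R * f (k + i)%N.

Lemma fdiff_exp0 (R : realType) (r k : nat) :
  fdiff r.+1 k (fun j => j%:R ^+ 0) = 0 :> R.
Proof.
have := exprDn (1 : R) (-1) r.+1; rewrite subrr expr0n /= => E; rewrite [RHS]E.
by apply: eq_bigr => i _; rewrite expr1n mul1r expr0 mulr1 mulr_natr.
Qed.

(** Split one factor k + i of the power: the part k comes out of the sum, and i is absorbed by the
    binomial coefficient, lowering the order and shifting the base point. *)
Lemma fdiff_expS (R : realType) (r k s : nat) :
  fdiff r.+1 k (fun j => j%:R ^+ s.+1) =
  k%:R * fdiff r.+1 k (fun j => j%:R ^+ s) -
  r.+1%:R * fdiff r k.+1 (fun j => j%:R ^+ s) :> R.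
Proof.
have -> : r.+1%:R * fdiff r k.+1 (fun j => j%:R ^+ s) =
    - \sum_(i < r.+2) (-1) ^+ i * 'C(r.+1, i)%:R * i%:R * (k + i)%:R ^+ s :> R.
  rewrite big_ord_recl /= mulr0 mul0r add0r /fdiff mulr_sumr -sumrN.
  apply: eq_bigr => i _; rewrite /bump leq0n add1n addSnnS.
  have E : 'C(r.+1, i.+1)%:R * i.+1%:R = r.+1%:R * 'C(r, i)%:R :> R.
    by rewrite -!natrM (mul_bin_diag r.+1 i) mulnC.
  transitivity ((-1) ^+ i * (r.+1%:R * 'C(r, i)%:R) * (k + i.+1)%:R ^+ s : R).
    by ring.
  by rewrite -E exprS; ring.
rewrite opprK /fdiff mulr_sumr -big_split /=; apply: eq_bigr => i _.
by rewrite exprS natrD; ring.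
Qed.

Lemma fdiff_exp (R : realType) (r k s : nat) : (s <= r)%N ->
  fdiff r k (fun j => j%:R ^+ s) = (s == r)%:R * ((-1) ^+ r * r`!%:R) :> R.
Proof.
elim: r k s => [|r IH] k s.
  by rewrite leqn0 => /eqP ->; rewrite /fdiff big_ord1 !expr0 !mulr1.
elim: s => [|s IHs] sr; first by rewrite fdiff_exp0 mul0r.
rewrite fdiff_expS IHs ?IH//; last exact: ltnW.
rewrite eqSS (ltn_eqF (sr : s < r.+1)%N) mul0r mulr0 sub0r exprS factS natrM.
by ring.
Qed.

(** A difference of order r kills the powers j^s with s < r, so division by delta^r isolates the
    coefficient of index r up to terms with a positive power of delta. The error o(delta^D) survives
    the division because r <= D. *)
Lemma cvgn_fdiff (R : realType) (D N r k : nat) (delta : nat -> R)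
    (c : nat -> nat -> R) (p : nat -> {poly R}) (q : {poly R}) :
  (forall n, 0 < delta n) -> delta @ \oo --> (0 : R) ->
  (forall n, (size (p n) <= N)%N) -> (D < N)%N ->
  (forall i, (fun n => (p n)`_i) @ \oo --> q`_i) ->
  (forall j, (j <= D)%N ->
    (fun n => (c n j - (p n).[delta n * j%:R]) / delta n ^+ D) @ \oo --> (0 : R)) ->
  (k + r <= D)%N ->
  (fun n => fdiff r k (c n) / delta n ^+ r) @ \oo --> (-1) ^+ r * r`!%:R * q`_r.
Proof.
move=> d0 dcvg sp DN pq cp krD.
have d0' n : delta n != 0 by rewrite gt_eqF.
pose w i := (-1) ^+ i * 'C(r, i)%:R : R.
pose err n := \sum_(i < r.+1) w i *
  ((c n (k + i)%N - (p n).[delta n * (k + i)%:R]) / delta n ^+ D * delta n ^+ (D - r)).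
(* For s < r the difference of j^s is zero, so 0 stands in for the negative power of delta. *)
pose mn n := \sum_(s < N) (p n)`_s *
  (fdiff r k (fun j => j%:R ^+ s) * (if (s < r)%N then 0 else delta n ^+ (s - r))).
have main n : err n + mn n = fdiff r k (c n) / delta n ^+ r.
  have -> : mn n = \sum_(i < r.+1) w i * ((p n).[delta n * (k + i)%:R] / delta n ^+ r).
    rewrite (eq_bigr (fun i : 'I_r.+1 => \sum_(s < N) w i *
        ((p n)`_s * (delta n * (k + i)%:R) ^+ s / delta n ^+ r))); last first.
      by move=> i _; rewrite (horner_coef_wide _ (sp n)) mulr_suml mulr_sumr.
    rewrite exchange_big /=; apply: eq_bigr => s _.
    have [sr|rs] := ltnP s r.
      transitivity ((p n)`_s * (delta n ^+ s / delta n ^+ r) *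
          fdiff r k (fun j => j%:R ^+ s)).
        by rewrite fdiff_exp ?(ltn_eqF sr)// ?mul0r ?mulr0// ltnW.
      rewrite /fdiff mulr_sumr; apply: eq_bigr => i _.
      by rewrite /w exprMn; ring.
    rewrite mulr_suml mulr_sumr; apply: eq_bigr => i _.
    have -> : delta n ^+ (s - r) = delta n ^+ s / delta n ^+ r.
      by rewrite expfB_cond// (negbTE (d0' n)).
    by rewrite /w exprMn; ring.
  rewrite -big_split /fdiff mulr_suml; apply: eq_bigr => i _ /=.
  have -> : delta n ^+ (D - r) = delta n ^+ D / delta n ^+ r.
    by rewrite expfB_cond ?(negbTE (d0' n))//; lia.
  rewrite -/(w i); field.
  by rewrite !expf_neq0.
have err0 : err @ \oo --> (0 : R).
  have E : \sum_(i < r.+1) w i * (0 * 0 ^+ (D - r)) = 0.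
    by rewrite big1// => i _; rewrite mul0r mulr0.
  apply: (@cvgn_ext _ err _ (\sum_(i < r.+1) w i * (0 * 0 ^+ (D - r)))) => //.
  apply: cvgn_sum => i; apply: cvgM; first exact: cvg_cst.
  apply: cvgM; last exact: cvgn_exp.
  by apply: cp; have := ltn_ord i; lia.
have mn0 : mn @ \oo --> (-1) ^+ r * r`!%:R * q`_r.
  have rN : (r < N)%N by lia.
  have E : \sum_(s < N) q`_s * (fdiff r k (fun j => j%:R ^+ s) * (s == r :> nat)%:R) =
      (-1) ^+ r * r`!%:R * q`_r.
    rewrite (bigD1 (Ordinal rN))//= eqxx mulr1 fdiff_exp// eqxx mul1r big1 ?addr0.
      by rewrite mulrC.
    by move=> s; rewrite -val_eqE /= => /negbTE ->; rewrite !mulr0.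
  rewrite -E; apply: cvgn_sum => s; apply: cvgM; first exact: pq.
  apply: cvgM; first exact: cvg_cst.
  case: ltngtP => sr; first exact: cvg_cst.
    apply: (@cvgn_ext _ (fun n => delta n ^+ (s - r)) _ (0 ^+ (s - r))) => //.
      by rewrite expr0n subn_eq0 leqNgt sr.
    exact: cvgn_exp.
  rewrite sr subnn; apply: (@cvgn_ext _ (fun=> 1) _ 1) (cvg_cst _) => // n.
apply: (@cvgn_ext _ (fun n => err n + mn n) _ (0 + (-1) ^+ r * r`!%:R * q`_r)) => //.
  by rewrite add0r.
exact: cvgD.
Qed.

(** * Calculus of expansions in powers of delta(n) j *)

Lemma cvgn_eq (R : realType) (u : nat -> R) (a : R) : u @ \oo --> a ->
  forall (v : nat -> R) (b : R), u =1 v -> a = b -> v @ \oo --> b.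
Proof. by move=> ua v b /funext <- <-. Qed.

(** The polynomials [p n] vary with n because the quotients g_k(n) / delta(n)^k merely tend to zero.
    The uniform size bound reduces all limits to finite sums. *)
Definition has_symbol {R : realType} (D : nat) (delta : nat -> R)
    (F : nat -> nat -> R) (q : {poly R}) : Prop :=
  exists N (p : nat -> {poly R}),
    [/\ (D < N)%N, forall n, (size (p n) <= N)%N,
        forall i, (fun n => (p n)`_i) @ \oo --> q`_i &
        forall j, (j <= D)%N ->
          (fun n => (F n j - (p n).[delta n * j%:R]) / delta n ^+ D) @ \oo --> (0 : R)].

Lemma cvgn_horner (R : realType) (N : nat) (p : nat -> {poly R}) (q : {poly R})
    (x : nat -> R) (a : R) :
  (forall n, (size (p n) <= N)%N) -> (forall i, (fun n => (p n)`_i) @ \oo --> q`_i) ->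
  (size q <= N)%N -> x @ \oo --> a -> (fun n => (p n).[x n]) @ \oo --> q.[a].
Proof.
move=> sp pq sq xa; rewrite (horner_coef_wide _ sq).
apply: (@cvgn_ext _ (fun n => \sum_(i < N) (p n)`_i * x n ^+ i) _
   (\sum_(i < N) q`_i * a ^+ i)) => //.
  by move=> n; rewrite (horner_coef_wide _ (sp n)).
by apply: cvgn_sum => i; apply: cvgM; [apply: pq|apply: cvgn_exp].
Qed.

Lemma size_limit_le (R : realType) (N : nat) (p : nat -> {poly R}) (q : {poly R}) :
  (forall n, (size (p n) <= N)%N) -> (forall i, (fun n => (p n)`_i) @ \oo --> q`_i) ->
  (size q <= N)%N.
Proof.
move=> sp pq; apply/leq_sizeP => j Nj.
have := pq j; rewrite (_ : (fun n => _) = fun=> 0); last first.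
  by apply/funext => n; rewrite nth_default// (leq_trans (sp n)).
by move=> /(cvg_unique (@norm_hausdorff _ R)) /(_ (cvg_cst _)).
Qed.

Lemma has_symbol_const (R : realType) (D : nat) (delta : nat -> R) (a : R) :
  has_symbol D delta (fun _ _ => a) a%:P.
Proof.
exists D.+1, (fun=> a%:P); split => // [n|i|j jD].
- by rewrite (leq_trans (size_polyC_leq1 _)).
- exact: cvg_cst.
- apply: (@cvgn_ext _ (fun=> 0) _ 0) (cvg_cst _) => // n.
  by rewrite hornerC subrr mul0r.
Qed.

Lemma has_symbolD (R : realType) (D : nat) (delta : nat -> R)
    (F F' : nat -> nat -> R) (q q' : {poly R}) :
  has_symbol D delta F q -> has_symbol D delta F' q' ->
  has_symbol D delta (fun n j => F n j + F' n j) (q + q').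
Proof.
move=> [N [p [DN sp pq Fp]]] [N' [p' [DN' sp' pq' Fp']]].
exists (maxn N N'), (fun n => p n + p' n); split.
- by rewrite leq_max DN.
- move=> n; rewrite (leq_trans (size_polyD _ _))// geq_max !leq_max sp sp' orbT//.
- move=> i; rewrite coefD.
  apply: (@cvgn_ext _ (fun n => (p n)`_i + (p' n)`_i) _ (q`_i + q'`_i)) => //.
    by move=> n; rewrite coefD.
  exact: cvgD.
- move=> j jD; apply: (cvgn_eq _ _ _ (cvgD (Fp j jD) (Fp' j jD))).
    by move=> n; rewrite -[LHS]/(_ / _ + _ / _) hornerD; ring.
  by rewrite addr0.
Qed.

Lemma has_symbol_sum (R : realType) (D : nat) (delta : nat -> R) (I : Type) (r : seq I)
    (F : I -> nat -> nat -> R) (q : I -> {poly R}) :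
  (forall i, has_symbol D delta (F i) (q i)) ->
  has_symbol D delta (fun n j => \sum_(i <- r) F i n j) (\sum_(i <- r) q i).
Proof.
move=> Fq; elim: r => [|i r IH].
  rewrite big_nil (_ : (fun n j => _) = fun _ _ => 0); first exact: has_symbol_const.
  by apply/funext => n; apply/funext => j; rewrite big_nil.
rewrite big_cons (_ : (fun n j => _) = fun n j => F i n j + \sum_(j0 <- r) F j0 n j).
  exact: has_symbolD.
by apply/funext => n; apply/funext => j; rewrite big_cons.
Qed.

(** Write F F' - p p' = (F - p) F' + p (F' - p'); after division by delta^D both terms vanish in the
    limit since F' and p(delta j) converge. *)
Lemma has_symbolM (R : realType) (D : nat) (delta : nat -> R)
    (F F' : nat -> nat -> R) (q q' : {poly R}) :
  (forall n, 0 < delta n) -> delta @ \oo --> (0 : R) ->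
  has_symbol D delta F q -> has_symbol D delta F' q' ->
  has_symbol D delta (fun n j => F n j * F' n j) (q * q').
Proof.
move=> d0 dcvg [N [p [DN sp pq Fp]]] [N' [p' [DN' sp' pq' Fp']]].
have d0' n : delta n ^+ D != 0 by rewrite expf_neq0// gt_eqF.
have xj j : (fun n => delta n * j%:R) @ \oo --> (0 : R).
  apply: (cvgn_eq _ _ _ (cvgM dcvg (cvg_cst (j%:R : R)))) => //.
  by rewrite mul0r.
have cp j := cvgn_horner _ _ _ _ _ _ sp pq (size_limit_le _ _ _ _ sp pq) (xj j).
have cp' j := cvgn_horner _ _ _ _ _ _ sp' pq' (size_limit_le _ _ _ _ sp' pq') (xj j).
have cF' j : (j <= D)%N -> (fun n => F' n j) @ \oo --> 0 * 0 ^+ D + q'.[0].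
  move=> jD; apply: (cvgn_eq _ _ _ (cvgD (cvgM (Fp' j jD) (cvgn_exp _ _ _ D dcvg)) (cp' j))) => // n.
  by rewrite -[LHS]/(_ / _ * _ + _) divfK// subrK.
exists (N + N')%N, (fun n => p n * p' n); split.
- lia.
- move=> n; rewrite (leq_trans (size_polyMleq _ _))// (leq_trans (leq_pred _))//.
  by rewrite leq_add.
- move=> i; rewrite coefM.
  apply: (@cvgn_ext _ (fun n => \sum_(k < i.+1) (p n)`_k * (p' n)`_(i - k)) _
     (\sum_(k < i.+1) q`_k * q'`_(i - k))) => //.
    by move=> n; rewrite coefM.
  by apply: cvgn_sum => k; apply: cvgM.
- move=> j jD.
  apply: (cvgn_eq _ _ _ (cvgD (cvgM (Fp j jD) (cF' j jD)) (cvgM (cp j) (Fp' j jD)))).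
    move=> n; rewrite hornerM.
    rewrite -[LHS]/((F n j - (p n).[delta n * j%:R]) / delta n ^+ D * F' n j +
      (p n).[delta n * j%:R] * ((F' n j - (p' n).[delta n * j%:R]) / delta n ^+ D)).
    by ring.
  by rewrite mul0r mulr0 addr0.
Qed.

Lemma has_symbolX (R : realType) (D : nat) (delta : nat -> R)
    (F : nat -> nat -> R) (q : {poly R}) (k : nat) :
  (forall n, 0 < delta n) -> delta @ \oo --> (0 : R) ->
  has_symbol D delta F q -> has_symbol D delta (fun n j => F n j ^+ k) (q ^+ k).
Proof.
move=> d0 dcvg Fq; elim: k => [|k IH]; first exact: has_symbol_const.
rewrite exprS (_ : (fun n j => _) = fun n j => F n j * F n j ^+ k).
  exact: has_symbolM.
by apply/funext => n; apply/funext => j; rewrite exprS.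
Qed.

Lemma has_symbol_comp (R : realType) (D : nat) (delta : nat -> R)
    (F : nat -> nat -> R) (q t : {poly R}) :
  (forall n, 0 < delta n) -> delta @ \oo --> (0 : R) ->
  has_symbol D delta F q -> has_symbol D delta (fun n j => t.[F n j]) (t \Po q).
Proof.
move=> d0 dcvg Fq; rewrite comp_polyE.
rewrite (_ : (fun n j => _) = fun n j => \sum_(i < size t) t`_i * F n j ^+ i); last first.
  by apply/funext => n; apply/funext => j; rewrite horner_coef.
apply: has_symbol_sum => i; rewrite -mul_polyC.
by apply: has_symbolM => //; [apply: has_symbol_const|apply: has_symbolX].
Qed.

(** As F = o(delta), the Taylor remainder O(|F|^D) is o(delta^D). So D terms of the exponential
    suffice and the remainder has symbol 0. *)
Lemma has_symbol_expR (R : realType) (D : nat) (delta : nat -> R)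
    (F : nat -> nat -> R) (q : {poly R}) :
  (forall n, 0 < delta n) -> delta @ \oo --> (0 : R) -> (0 < D)%N ->
  (forall j, (j <= D)%N -> (fun n => F n j / delta n) @ \oo --> (0 : R)) ->
  has_symbol D delta F q ->
  has_symbol D delta (fun n j => expR (F n j)) (exp_poly D \Po q).
Proof.
move=> d0 dcvg D0 F0 Fq.
rewrite (_ : (fun n j => _) = fun n j => (exp_poly D).[F n j] +
   (expR (F n j) - (exp_poly D).[F n j])); last first.
  by apply/funext => n; apply/funext => j; rewrite addrC subrK.
rewrite -[_ \Po _]addr0; apply: has_symbolD; first exact: has_symbol_comp.
exists D.+1, (fun=> 0); split => // [n|i|j jD].
- by rewrite size_poly0.
- by rewrite coef0; exact: cvg_cst.
have Fj0 : (fun n => F n j) @ \oo --> (0 : R).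
  apply: (cvgn_eq _ _ _ (cvgM (F0 j jD) dcvg)); last by rewrite mulr0.
  by move=> n; rewrite -[LHS]/(_ / _ * _) divfK// gt_eqF.
have [N FN] := cvgn_eventually _ _ _ 1 ltr01 Fj0.
apply: (@cvgn_abs_le _ _ (fun n => expR 1 * `|F n j / delta n| ^+ D)).
  exists N => n Nn; have F1 : `|F n j| <= 1 by rewrite -[F n j]subr0 FN.
  rewrite horner0 subr0 normrM normfV normrX normrM normfV exprMn exprVn mulrA.
  by rewrite ler_wpM2r ?invr_ge0 ?exprn_ge0// expR_sub_exp_poly.
apply: (cvgn_eq _ _ _ (cvgM (cvg_cst (expR 1 : R)) (cvgn_exp _ _ _ D (cvg_norm (F0 j jD))))) => //; by rewrite normr0 expr0n (gtn_eqF D0) mulr0.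
Qed.

(** * Limits of the finite differences for a log-polynomial sequence *)

Lemma hermite_number_double (R : realType) (kappa : R) (l : nat) :
  hermite_number kappa l.*2 = l.*2`!%:R * (kappa ^+ l / l`!%:R).
Proof.
have nz k : k`!%:R != 0 :> R by rewrite pnatr_eq0 -lt0n fact_gt0.
apply: (mulIf (nz l)); rewrite -mulrA divfK//.
elim: l => [|l IH]; first by rewrite !mulr1.
rewrite doubleS hermite_numberSS 3!factS !natrM exprS.
have -> : l.*2.+2%:R = 2 * l.+1%:R :> R by rewrite -doubleS -muln2 natrM mulrC.
transitivity (2 * kappa * l.*2.+1%:R * l.+1%:R * (hermite_number kappa l.*2 * l`!%:R)).
  by ring.
by rewrite IH; ring.
Qed.

(** Truncation loses nothing: the coefficient of index r = 2l comes from the l-th exponential term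
    alone, and l < D. For odd r both sides vanish, so the sign disappears. *)
Lemma coef_exp_poly_comp (R : realType) (kappa : R) (D r : nat) :
  (1 < D)%N -> (r <= D)%N ->
  (-1) ^+ r * r`!%:R * (exp_poly D \Po (kappa *: 'X^2))`_r = hermite_number kappa r.
Proof.
move=> D1 rD; rewrite /exp_poly poly_def raddf_sum /= coef_sum.
have -> : \sum_(i < D) (((i`!%:R)^-1 *: 'X^i) \Po (kappa *: 'X^2))`_r =
    \sum_(i < D) (i`!%:R)^-1 * (kappa ^+ i * (r == i.*2)%:R).
  apply: eq_bigr => i _.
  by rewrite comp_polyZ comp_Xn_poly exprZn -exprM !coefZ coefXn mul2n.
case: (boolP (odd r)) => odr.
  rewrite hermite_number_odd// big1 ?mulr0// => i _.
  by case: eqP => [E|]; rewrite ?mulr0//; move: odr; rewrite E odd_double.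
have rE : r = (r./2).*2 by rewrite even_halfK.
rewrite rE; move: r./2 rE => l rE {odr}.
have lD : (l < D)%N by lia.
rewrite hermite_number_double (bigD1 (Ordinal lD))//= eqxx mulr1 big1 ?addr0.
  by rewrite -mul2n exprM sqrrN !expr1n mul1r [_^-1 * _]mulrC.
move=> i; rewrite -val_eqE /= => il; case: eqP => [E|]; rewrite ?mulr0//.
by move/eqP: il; lia.
Qed.

(** The exponential factor removes the linear term A(n) j, which need not be small. *)
Definition normalized_ratio {R : realType} (alpha A : nat -> R) (n j : nat) : R :=
  alpha (n + j)%N / alpha n * expR (- (A n * j%:R)).

Lemma log_polynomial_fdiff (R : realType) (m : nat) (alpha A : nat -> R) (kappa : R)
    (delta : nat -> R) :
  (forall n, 0 < alpha n) -> log_polynomial m alpha A kappa delta ->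
  (forall n, 0 < delta n) /\
  forall k r, (k + r <= m.+1)%N ->
    (fun n => fdiff r k (normalized_ratio alpha A n) / delta n ^+ r) @ \oo
      --> hermite_number kappa r.
Proof.
move=> a0 [m2 [_ [g [d0 [dcvg [gd logd]]]]]]; split=> // k r krm.
pose F n j := ln (alpha (n + j)%N / alpha n) - A n * j%:R.
(* These are the coefficients of the logarithmic expansion in the variable delta(n) j; only the one
   of index 2 has a nonzero limit. *)
pose e (i n : nat) : R := if i == 2%N then kappa else if (2 < i <= m)%N then g i n / delta n ^+ i else 0.
pose p n := \poly_(i < m.+1) e i n.
have d0' n : delta n != 0 by rewrite gt_eqF.
have ei i : (fun n => e i n) @ \oo --> kappa * (i == 2%N)%:R.
  rewrite /e; case: eqP => [_|_]; first by rewrite mulr1; exact: cvg_cst.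
  rewrite mulr0; case: (boolP (2 < i <= m)%N) => im; last exact: cvg_cst.
  apply: little_o_cvg => [n|]; first by rewrite exprn_gt0.
  exact: gd.
have pi i : (fun n => (p n)`_i) @ \oo --> (kappa *: 'X^2 : {poly R})`_i.
  rewrite coefZ coefXn; apply: (cvgn_eq _ _ _ (ei i)) => // n.
  rewrite coef_poly; case: ltnP => // im; rewrite /e.
  by case: eqP => [i2|_]; [lia | case: ifP => //; lia].
have pE n j : (p n).[delta n * j%:R] = kappa * delta n ^+ 2 * j%:R ^+ 2 +
    \sum_(3 <= k < m.+1) g k n * j%:R ^+ k.
  rewrite horner_poly -(big_mkord xpredT (fun i => e i n * (delta n * j%:R) ^+ i)).
  rewrite (big_cat_nat (n := 3))//=.
  rewrite 3?big_nat_recr//= big_geq// /e /= !mul0r !add0r exprMn mulrA; congr (_ + _).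
  apply: eq_big_nat => i /andP[i3 im].
  have -> : (i == 2%N) = false by apply/eqP; lia.
  have -> : (2 < i <= m)%N by lia.
  by rewrite exprMn mulrA divfK// expf_neq0.
have Fp j : (j <= m.+1)%N ->
    (fun n => (F n j - (p n).[delta n * j%:R]) / delta n ^+ m.+1) @ \oo --> (0 : R).
  (* The hypothesis starts at j = 1; for j = 0 the logarithm and the polynomial are both zero. *)
  case: j => [_|j jm].
    apply: (cvgn_eq _ _ _ (cvg_cst (0 : R))) => // n.
    rewrite pE /F addn0 divff ?gt_eqF// ln1 big1_seq.
      by rewrite mulr0 expr0n /= mulr0 addr0 !subr0 mul0r.
    move=> i; rewrite mem_index_iota => /andP[_ /andP[i3 _]].
    by rewrite expr0n gtn_eqF ?mulr0// (leq_trans _ i3).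
  have := little_o_cvg _ _ _ _ (logd j.+1 jm) => /(_ (fun n => exprn_gt0 _ (d0 n))) L.
  apply: (cvgn_eq _ _ _ L) => // n; rewrite pE /F; congr (_ / _).
  by rewrite !opprD !addrA.
have Fd j : (j <= m.+1)%N -> (fun n => F n j / delta n) @ \oo --> (0 : R).
  move=> jm.
  have L1 : (fun n => (F n j - (p n).[delta n * j%:R]) / delta n ^+ m.+1 * delta n ^+ m)
      @ \oo --> (0 : R).
    have := cvgM (Fp j jm) (cvgn_exp _ _ _ m dcvg).
    by rewrite mul0r; apply.
  (* The terms of index below 2 vanish identically, and each other one keeps a positive power of
     delta after the division. *)
  have L2 : (fun n => \sum_(i < m.+1) e i n * (delta n * j%:R) ^+ i / delta n) @ \oo -->
      \sum_(i < m.+1) (0 : R).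
    apply: cvgn_sum => i; case: (leqP 2 i) => i2.
      apply: (cvgn_eq _ _ _ (cvgM (cvgM (ei i) (cvgn_exp _ _ _ i.-1 dcvg))
        (cvg_cst (j%:R ^+ i : R)))) => [n|].
        rewrite -[LHS]/(_ * _ * _) exprMn.
        have -> : delta n ^+ i = delta n ^+ i.-1 * delta n by rewrite -exprSr prednK//; lia.
        by field.
      by rewrite expr0n (_ : (i.-1 == 0%N) = false) ?mulr0 ?mul0r//; apply/eqP; lia.
    apply: (cvgn_eq _ _ _ (cvg_cst (0 : R))) => // n.
    have i3 : (2 < i)%N = false by lia.
    by rewrite /e (ltn_eqF i2) i3 !mul0r.
  apply: (cvgn_eq _ _ _ (cvgD L1 L2)) => [n|]; last by rewrite big1 ?addr0.
  rewrite -[LHS]/(_ + _) -mulr_suml -(horner_poly m.+1 (fun i => e i n)) -/(p n) exprS.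
  field.
  by rewrite d0' expf_neq0.
have symF : has_symbol m.+1 delta F (kappa *: 'X^2).
  exists m.+2, p; split => // n; rewrite (leq_trans (size_poly _ _))//.
have [N [q [DN sq qi cq]]] := has_symbol_expR _ _ _ _ _ d0 dcvg (ltn0Sn m) Fd symF.
have expF n j : expR (F n j) = normalized_ratio alpha A n j.
  by rewrite /F /normalized_ratio expRD lnK ?expRN// posrE divr_gt0.
rewrite -(coef_exp_poly_comp R kappa m.+1 r); [|lia|lia].
apply: (cvgn_fdiff _ _ _ _ _ _ _ _ _ d0 dcvg sq DN qi _ krm) => j jm.
by apply: (cvgn_eq _ _ _ (cq j jm)) => // n; rewrite expF.
Qed.

(** * Affine rescaling of the Jensen polynomials *)

Lemma coef_affine_exp (R : comNzRingType) (a b : R) (j k : nat) :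
  ((a *: 'X + b%:P) ^+ j)`_k = 'C(j, k)%:R * a ^+ k * b ^+ (j - k).
Proof.
rewrite addrC exprDn coef_sum.
have E (i : 'I_j.+1) : (b%:P ^+ (j - i) * (a *: 'X) ^+ i *+ 'C(j, i))`_k =
    'C(j, i)%:R * a ^+ i * b ^+ (j - i) * (k == i)%:R.
  rewrite coefMn exprZn -polyC_exp -scalerAr coefZ coefCM coefXn -mulr_natl.
  by ring.
rewrite (eq_bigr _ (fun i _ => E i)).
have [kj|jk] := leqP k j.
  rewrite (bigD1 (Ordinal (kj : k < j.+1)%N))//= eqxx mulr1 big1 ?addr0// => i.
  by rewrite -val_eqE /= eq_sym => /negbTE ->; rewrite mulr0.
rewrite bin_small// !mul0r big1// => i _.
by rewrite gtn_eqF ?mulr0// (leq_ltn_trans _ jk)// -ltnS.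
Qed.

Lemma bin_mul_bin (d k i : nat) : (k + i <= d)%N ->
  ('C(d, k + i) * 'C(k + i, k) = 'C(d, k) * 'C(d - k, i))%N.
Proof.
move=> kid.
have h1 := @bin_fact d (k + i) kid.
have h2 := @bin_fact (k + i) k (leq_addr _ _).
have h3 := @bin_fact d k (leq_trans (leq_addr _ _) kid).
have h4 : ('C(d - k, i) * (i`! * (d - k - i)`!) = (d - k)`!)%N by apply: bin_fact; lia.
rewrite addKn in h2; rewrite -subnDA in h4.
apply/eqP; rewrite -(eqn_pmul2r (fact_gt0 k)) -(eqn_pmul2r (fact_gt0 i)).
rewrite -(eqn_pmul2r (fact_gt0 (d - (k + i)))); apply/eqP.
transitivity d`!; first by rewrite -h1 -h2; ring.
by rewrite -h3 -h4; ring.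
Qed.

Definition rescaled_jensen {R : realType} (d : nat) (delta : R) (c : nat -> R) :
    {poly R} :=
  \poly_(k < d.+1) ('C(d, k)%:R * (fdiff (d - k) k c / delta ^+ (d - k))).

(** The substitution is (delta X - 1) / rho, so rho^j cancels. The coefficient of X^k is s delta^k
    times the sum of C(d,j) C(j,k) (-1)^(j-k) c(j), which [bin_mul_bin] turns into a difference of
    order d - k at k. *)
Lemma comp_rescaled_jensen (R : realType) (d : nat) (delta rho s : R) (c : nat -> R) :
  delta != 0 -> rho != 0 ->
  (\sum_(j < d.+1) ('C(d, j)%:R * (s * rho ^+ j * c j)) *: 'X^j)
    \Po ((delta / rho) *: 'X + (- rho^-1)%:P) =
  (s * delta ^+ d) *: rescaled_jensen d delta c.
Proof.
move=> d0 r0; apply/polyP => k; rewrite raddf_sum /= coef_sum coefZ coef_poly.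
have E (j : 'I_d.+1) : ((('C(d, j)%:R * (s * rho ^+ j * c j)) *: 'X^j) \Po
    ((delta / rho) *: 'X + (- rho^-1)%:P))`_k =
    s * ('C(d, j)%:R * 'C(j, k)%:R * delta ^+ k * (-1) ^+ (j - k) * c j).
  rewrite comp_polyZ comp_Xn_poly coefZ coef_affine_exp.
  have [kj|jk] := leqP k j; last by rewrite (@bin_small j k)//; ring.
  have -> : rho ^+ j = rho ^+ k * rho ^+ (j - k) by rewrite -exprD subnKC.
  rewrite -[- rho^-1]mulN1r 2!exprMn !exprVn.
  field.
  by rewrite !expf_neq0.
rewrite (eq_bigr _ (fun j _ => E j)); case: ltnP => [kd|dk]; last first.
  rewrite mulr0 big1// => j _; rewrite (@bin_small j k); first by ring.
  by rewrite (leq_trans (ltn_ord j)).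
rewrite -(big_mkord xpredT
  (fun j => s * ('C(d, j)%:R * 'C(j, k)%:R * delta ^+ k * (-1) ^+ (j - k) * c j))).
rewrite (big_cat_nat (n := k))//=; last exact: ltnW.
rewrite big1_seq ?add0r; last first.
  move=> j; rewrite mem_index_iota => /andP[_ /andP[_ jk]].
  by rewrite (@bin_small j k)//; ring.
rewrite -{1}[k]add0n big_addn big_mkord /fdiff subSn//.
rewrite mulr_suml !mulr_sumr; apply: eq_bigr => i _.
rewrite addnK [(i + k)%N]addnC.
have ikd : (k + i <= d)%N by have := ltn_ord i; rewrite ltnS; lia.
have -> : 'C(d, k + i)%:R * 'C(k + i, k)%:R = 'C(d, k)%:R * 'C(d - k, i)%:R :> R.
  by rewrite -!natrM bin_mul_bin.
have -> : delta ^+ d = delta ^+ k * delta ^+ (d - k) by rewrite -exprD subnKC.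
field.
by rewrite expf_neq0.
Qed.

(** A real affine bijection carries zeros to zeros and preserves reality; the chain rule gives the
    same for the zeros of the derivatives. *)
Lemma hermite_like_affine (R : realType) (kappa a b s : R) (d : nat) (p q : {poly R}) :
  a != 0 -> s != 0 -> p \Po (a *: 'X + b%:P) = s *: q ->
  hermite_like R kappa d q -> hermite_like R kappa d p.
Proof.
move=> a0 s0 pq [dq [rq nq]].
have ca0 : (a%:C)%C != 0 :> R[i] by apply: contra a0 => /eqP[->].
have cs0 : (s%:C)%C != 0 :> R[i] by apply: contra s0 => /eqP[->].
pose y (z : R[i]) := (z - (b%:C)%C) / (a%:C)%C.
have Imy z : complex.Im (y z) = complex.Im z / a.
  rewrite /y Im_mulc; case: z => u v /=.
  by rewrite expr0n /= addr0; field.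
have yE z : (a%:C)%C * y z + (b%:C)%C = z by rewrite /y mulrC divfK// subrK.
have evC f g z : f \Po (a *: 'X + b%:P) = g ->
    (complexify f).[z] = (complexify g).[y z].
  move=> <-; rewrite complexify_comp horner_comp complexifyD complexifyZ complexifyX.
  rewrite [complexify b%:P](map_polyC (real_complex R)).
  by rewrite hornerD hornerZ hornerX hornerC yE.
have rpE z : root (complexify p) z = root (complexify q) (y z).
  by rewrite !rootE (evC _ _ _ pq) complexifyZ hornerZ mulf_eq0 (negbTE cs0).
have pq' : p^`() \Po (a *: 'X + b%:P) = (s / a) *: q^`().
  have := congr1 deriv pq; rewrite deriv_comp derivZ derivD derivZ derivX derivC addr0.
  rewrite alg_polyC mulrC mul_polyC => E.
  by rewrite -[LHS](scalerK a0) E scalerA mulrC.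
have csa0 : ((s / a)%:C)%C != 0 :> R[i].
  by have : s / a != 0 by [rewrite mulf_neq0// invr_eq0]; apply: contra => /eqP[->].
have rp'E z : root (complexify p^`()) z = root (complexify q^`()) (y z).
  by rewrite !rootE (evC _ _ _ pq') complexifyZ hornerZ mulf_eq0 (negbTE csa0).
have realE z : (complex.Im (y z) = 0) <-> (complex.Im z = 0).
  rewrite Imy; split=> [/eqP|->]; last by rewrite mul0r.
  by rewrite mulf_eq0 invr_eq0 (negbTE a0) orbF => /eqP.
have yV z : y ((a%:C)%C * z + (b%:C)%C) = z by rewrite /y addrK mulrC mulKf.
split; [|split] => [|kE z|kE].
- by move=> z; rewrite rpE rp'E; apply: dq.
- by rewrite rpE => /(rq kE) /realE.
- have := nq kE; rewrite /zeros_nonreal_but_one_if_odd; case: ifP => _.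
    move=> [w [[rw w0] wu]]; exists ((a%:C)%C * w + (b%:C)%C); split.
      by rewrite rpE yV; split => //; apply/realE; rewrite yV.
    move=> z [rz z0]; rewrite (wu (y z)) ?yE//; split; first by rewrite -rpE.
    exact/realE.
  move=> nr z; rewrite rpE => /nr; apply: contra => /eqP z0.
  by apply/eqP/realE.
Qed.

Lemma eventually_forall_lt (P : nat -> nat -> Prop) (K : nat) :
  (forall k, (k < K)%N -> exists N, forall n, (N <= n)%N -> P k n) ->
  exists N, forall n, (N <= n)%N -> forall k, (k < K)%N -> P k n.
Proof.
elim: K => [|K IH] PK; first by exists 0%N.
have [N1 H1] := IH (fun k kK => PK k (ltnW kK)).
have [N2 H2] := PK K (ltnSn K).
exists (maxn N1 N2) => n; rewrite geq_max => /andP[n1 n2] k.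
rewrite ltnS leq_eqVlt => /orP[/eqP ->|]; [exact: H2|exact: H1].
Qed.

Lemma rescaled_jensen_hermite_like (R : realType) (kappa : R) (d : nat)
    (delta : nat -> R) (c : nat -> nat -> R) :
  (1 <= d)%N -> kappa = 1 \/ kappa = -1 ->
  (forall k r, (k + r <= d)%N ->
    (fun n => fdiff r k (c n) / delta n ^+ r) @ \oo --> hermite_number kappa r) ->
  exists N, forall n, (N <= n)%N ->
    hermite_like R kappa d (rescaled_jensen d (delta n) (c n)).
Proof.
move=> d1 kE cd; have [e e0 He] := hermite_like_close R kappa d d1 kE.
have [|N HN] := eventually_forall_lt
  (fun k n => `|(rescaled_jensen d (delta n) (c n) - hermite kappa d)`_k| <= e) d.+1.
  move=> k kd; have kd' : (k + (d - k) <= d)%N by rewrite subnKC.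
  have [N HN] := cvgn_eventually _ _ _ _ e0
    (cvgM (cvg_cst ('C(d, k)%:R : R)) (cd k (d - k)%N kd')).
  by exists N => n /HN; rewrite coefB coef_hermite coef_poly kd.
exists N => n Nn; apply: He; first exact: size_poly.
move=> k; have [kd|dk] := ltnP k d.+1; first exact: HN.
rewrite coefB coef_poly ltnNge dk /= nth_default ?subr0 ?normr0 ?(ltW e0)//.
by rewrite (leq_trans (size_poly _ _)).
Qed.

Lemma fdiff_rev (R : realType) (d r k : nat) (f : nat -> R) : (k + r <= d)%N ->
  fdiff r k (fun j => f (d - j)%N) = (-1) ^+ r * fdiff r (d - (k + r)) f.
Proof.
move=> krd; rewrite /fdiff (reindex_inj rev_ord_inj) mulr_sumr /=.
apply: eq_bigr => i _; rewrite subSS.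
have ir : (i <= r)%N by rewrite -ltnS.
rewrite bin_sub// !mulrA; congr (_ * _ * f _); last lia.
have -> : (-1) ^+ r = (-1) ^+ (r - i) * (-1) ^+ i :> R by rewrite -exprD subnK.
by rewrite -mulrA -expr2 sqrr_sign mulr1.
Qed.

(** Reversal multiplies a difference of order r by (-1)^r, which is harmless because h_r = 0 for odd
    r. *)
Lemma fdiff_rev_cvg (R : realType) (kappa : R) (d : nat)
    (delta : nat -> R) (c : nat -> nat -> R) :
  (forall k r, (k + r <= d)%N ->
    (fun n => fdiff r k (c n) / delta n ^+ r) @ \oo --> hermite_number kappa r) ->
  forall k r, (k + r <= d)%N ->
    (fun n => fdiff r k (fun j => c n (d - j)%N) / delta n ^+ r) @ \oo
      --> hermite_number kappa r.
Proof.
move=> cd k r krd; have krd' : (d - (k + r) + r <= d)%N by lia.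
apply: (cvgn_eq _ _ _ (cvgM (cvg_cst ((-1) ^+ r : R)) (cd _ _ krd'))).
  by move=> n; rewrite fdiff_rev// -mulrA.
case: (boolP (odd r)) => odr; first by rewrite hermite_number_odd// mulr0.
by rewrite -signr_odd (negbTE odr) mul1r.
Qed.

Lemma jensenJ_hermite_like (R : realType) (kappa : R) (alpha A : nat -> R)
    (delta : R) (d n : nat) :
  delta != 0 -> alpha n != 0 ->
  hermite_like R kappa d (rescaled_jensen d delta (normalized_ratio alpha A n)) ->
  hermite_like R kappa d (jensenJ alpha d n).
Proof.
move=> d0 a0; have e0 : expR (A n) != 0 by rewrite gt_eqF ?expR_gt0.
apply: (hermite_like_affine _ _ (delta / expR (A n)) (- (expR (A n))^-1)
  (alpha n * delta ^+ d)); rewrite ?mulf_neq0 ?invr_eq0 ?expf_neq0//.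
rewrite -(comp_rescaled_jensen R d delta (expR (A n)) (alpha n))//.
congr (_ \Po _); apply: eq_bigr => j _.
congr ((_ * _) *: _); rewrite /normalized_ratio mulrC expRN -expRM_natl [_%:R * _]mulrC.
by field; rewrite a0 gt_eqF ?expR_gt0.
Qed.

(** Here alpha(n+d-j) = alpha(n) exp(A(n) d) exp(-A(n))^j c_n(d-j), which dictates rho = exp(-A(n))
    and the scalar factor. *)
Lemma jensenK_hermite_like (R : realType) (kappa : R) (alpha A : nat -> R)
    (delta : R) (d n : nat) :
  delta != 0 -> alpha n != 0 ->
  hermite_like R kappa d
    (rescaled_jensen d delta (fun j => normalized_ratio alpha A n (d - j))) ->
  hermite_like R kappa d (jensenK alpha d n).
Proof.
move=> d0 a0; have e0 x : expR x != 0 :> R by rewrite gt_eqF ?expR_gt0.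
apply: (hermite_like_affine _ _ (delta / expR (- A n)) (- (expR (- A n))^-1)
  (alpha n * expR (A n * d%:R) * delta ^+ d));
  rewrite ?mulf_neq0 ?invr_eq0 ?expf_neq0//.
rewrite -(comp_rescaled_jensen R d delta (expR (- A n)) (alpha n * expR (A n * d%:R)))//.
congr (_ \Po _).
rewrite /jensenK (reindex_inj rev_ord_inj) /=; apply: eq_bigr => j _.
have jd : (j <= d)%N by rewrite -ltnS.
rewrite subSS subKn// bin_sub//; congr ((_ * _) *: _).
rewrite /normalized_ratio -expRM_natl.
have E : expR (A n * d%:R) * expR (j%:R * - A n) * expR (- (A n * (d - j)%:R)) = 1.
  by rewrite -!expRD natrB// -[RHS]expR0; congr expR; ring.
transitivity (alpha (n + (d - j))%N * (expR (A n * d%:R) * expR (j%:R * - A n) *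
    expR (- (A n * (d - j)%:R)))); first by rewrite E mulr1.
by field.
Qed.

(** * Log-concavity, log-convexity and the conclusion *)

(* As c_0 = 1, the Turan determinant c_0 c_2 - c_1^2 equals D^2 c - (D c)^2, with
   D^2 c ~ 2 kappa delta^2 and D c = o(delta). *)
Lemma log_polynomial_turan (R : realType) (m : nat) (alpha A : nat -> R) (kappa : R)
    (delta : nat -> R) :
  (forall n, 0 < alpha n) -> log_polynomial m alpha A kappa delta ->
  exists N, forall n, (N <= n)%N -> exists2 x : R, 0 < x &
    `|(alpha n * alpha n.+2 - alpha n.+1 ^+ 2) * x - 2 * kappa| <= 1.
Proof.
move=> a0 lp; have [d0 cd] := log_polynomial_fdiff _ _ _ _ _ _ a0 lp.
have m2 : (2 <= m)%N := lp.1.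
have c2 := cd 0%N 2%N (leqW m2); have c1 := cd 0%N 1%N isT.
have [N HN] := cvgn_eventually _ _ _ _ ltr01 (cvgB c2 (cvgn_exp _ _ _ 2 c1)).
(* This factor turns the determinant of alpha into that of c_n and divides it by delta^2. *)
exists N => n /HN H; exists ((expR (- A n) / (alpha n * delta n)) ^+ 2).
  by rewrite exprn_gt0// divr_gt0 ?expR_gt0// mulr_gt0.
have -> : (alpha n * alpha n.+2 - alpha n.+1 ^+ 2) *
    (expR (- A n) / (alpha n * delta n)) ^+ 2 =
  fdiff 2 0 (normalized_ratio alpha A n) / delta n ^+ 2 -
    (fdiff 1 0 (normalized_ratio alpha A n) / delta n ^+ 1) ^+ 2.
  rewrite /fdiff !big_ord_recl !big_ord0 /= /bump /= !add0n /normalized_ratio.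
  rewrite addn0 addn1 addn2 mulr0 oppr0 expR0 mulr1.
  have -> : expR (- (A n * 2)) = expR (- A n) ^+ 2 by rewrite -expRM_natl; congr expR; ring.
  rewrite divff ?gt_eqF// bin1 !binn !bin0.
  rewrite !addn0 addn1 -[1%:R]/(1 : R) (mulr1 (A n)) expr1.
  by field; rewrite !gt_eqF.
move: H; rewrite hermite_numberSS /= expr0n /= subr0 !mulr1.
by [].
Qed.

Theorem theorem1p7 (R : realType) (m : nat) (alpha A : nat -> R) (kappa : R)
    (delta : nat -> R) :
  (forall n, 0 < alpha n) ->
  log_polynomial m alpha A kappa delta ->
  ((kappa = -1 -> asymp_strictly_log_concave alpha) /\
   (kappa = 1 -> asymp_strictly_log_convex alpha)) /\
  (forall d : nat, (1 <= d <= m.+1)%N ->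
     exists N : nat, forall n : nat, (N <= n)%N ->
       forall P : {poly R}, (P = jensenJ alpha d n \/ P = jensenK alpha d n) ->
         distinct_zeros P /\
         (kappa = -1 -> all_zeros_real P) /\
         (kappa = 1 -> zeros_nonreal_but_one_if_odd d P)).
Proof.
move=> a0 lp; have [d0 cd] := log_polynomial_fdiff _ _ _ _ _ _ a0 lp.
split.
  have [N HN] := log_polynomial_turan _ _ _ _ _ _ a0 lp.
  (* A positive multiple of the determinant lies within 1 of 2 kappa, which is 2 or -2, so its sign
     is that of kappa. *)
  split=> kE; exists N => n /HN [x x0]; rewrite kE ler_distl => /andP[h1 h2].
    rewrite -subr_lt0 -(pmulr_llt0 _ x0); lra.
  rewrite -subr_gt0 -(pmulr_lgt0 _ x0); lra.
move=> d /andP[d1 dm].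
have cd' k r : (k + r <= d)%N ->
  (fun n => fdiff r k (normalized_ratio alpha A n) / delta n ^+ r) @ \oo
    --> hermite_number kappa r.
  by move=> krd; apply: cd; apply: leq_trans dm.
have [N1 H1] := rescaled_jensen_hermite_like _ _ _ _ _ d1 lp.2.1 cd'.
have [N2 H2] := rescaled_jensen_hermite_like _ _ _ _ _ d1 lp.2.1 (fdiff_rev_cvg _ _ _ _ _ cd').
exists (maxn N1 N2) => n; rewrite geq_max => /andP[/H1 h1 /H2 h2] P PE.
have d0' : delta n != 0 by rewrite gt_eqF.
have a0' : alpha n != 0 by rewrite gt_eqF.
have [sP cP] : hermite_like R kappa d P.
  case: PE => ->; [exact: (jensenJ_hermite_like _ _ _ A _ _ _ d0' a0' h1)|].
  exact: (jensenK_hermite_like _ _ _ A _ _ _ d0' a0' h2).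
by split => //; apply: simple_zeros_distinct.
Qed.
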